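(* For any graph $H$, there exists a 1-dof tree-decomposable graph $G$ that has $H$ as a minor and that has exactly two of the following three properties: (i) $G$ is LCC; (ii) $G$ is 1-path; (iii) $G$ is $K_3$-free.
   Context: All graphs are finite and simple. $H$ is a minor of $G$ if it can be obtained from $G$ by a sequence of deletions and edge contractions. A graph is $K_3$-free if it has no $K_3$ subgraph. A nonedge of a graph $G$ is a pair of distinct vertices not joined by an edge, and $G\cup f$ denotes $G$ with the edge $f$ added. A graph is tree-decomposable if it is a single edge, or it is the union of three tree-decomposable graphs such that each pair shares exactly one vertex and the three shared vertices are distinct. A graph $G$ is 1-dof tree-decomposable if it has a nonedge $f$ such that $G\cup f$ is tree-decomposable; every such $f$ is called a base nonedge of $G$. A cluster of a 1-dof tree-decomposable graph $G$ is a maximal tree-decomposable subgraph of $G$. Construction from a base nonedge $f=(v_0,v_0')$: $G$ is built starting from $G_f(0)$, the graph with the two vertices $v_0,v_0'$ and no edges. At the $k$-th construction step, written $v_k\triangleleft(u_k,w_k)$, two new clusters $T,T'$ of $G$ that share exactly one vertex $v_k$ (the step vertex) are appended to $G_f(k-1)$, where $T\cap G_f(k-1)$ is the single vertex $u_k$, $T'\cap G_f(k-1)$ is the single vertex $w_k$, and $u_k\neq w_k$; the result is $G_f(k)$. The steps may be ordered arbitrarily as long as $u_k,w_k\in G_f(k-1)$ for each $k$. The vertices $u_k,w_k$ are the base vertices of the step, and the vertices of $T\cup T'$ other than $u_k,w_k$ are the vertices added by the step. A construction step is final-level if no vertex added by it is a base vertex of any construction step. A construction of $G$ from $f$ is 1-path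 if it has exactly one final-level step. $G$ is 1-path if it is 1-dof tree-decomposable and has a 1-path construction from some base nonedge. The $k$-th extreme graph $\hat G_f(k)$ is $G_f(k-1)$ with the edge $(u_k,w_k)$ added. $G$ is LCC (has low Cayley complexity) on $f$ if all extreme graphs in the construction of $G$ from $f$ are tree-decomposable; $G$ is LCC if it is LCC on some base nonedge. *)

(* Defs.v *)
From Stdlib Require Import Relations.
From mathcomp Require Import all_boot.

Set Implicit Arguments.
Unset Strict Implicit.
Unset Printing Implicit Defensive.

(* A finite simple graph on some of the elements of an ambient finite type [T].
   Edges are two-element sets of vertices.  The ambient type serves to make
   sense of subgraphs, unions and intersections; elements of [T] outside [vset]
   play no role. *)
Record sgraph (T : finType) := SGraph {
  vset : {set T};
  eset : {set {set T}};
  sgraphP : [forall e in eset, (#|e| == 2) && (e \subset vset)]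
}.

Section Graphs.
Variable T : finType.
Implicit Types (G H : sgraph T) (V : {set T}) (E : {set {set T}}) (x y z : T).

Lemma mkgraph_subproof V E :
  [forall e in [set e in E | (#|e| == 2) && (e \subset V)],
     (#|e| == 2) && (e \subset V)].
Proof. by apply/forall_inP => e; rewrite inE => /andP[]. Qed.

(* The members of [E] that are not two-element subsets of [V] are dropped. *)
Definition mkgraph V E : sgraph T := SGraph (mkgraph_subproof V E).

Definition edge_graph x y := mkgraph [set x; y] [set [set x; y]].

Definition gunion G H := mkgraph (vset G :|: vset H) (eset G :|: eset H).

Definition add_edge G x y := mkgraph (vset G) ([set x; y] |: eset G).

Definition subgraph G H := (vset G \subset vset H) && (eset G \subset eset H).

Definition K3_free G :=
  ~ exists x y z, [/\ [set x; y] \in eset G, [set y; z] \in eset G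
                    & [set x; z] \in eset G].

(* The incident edges are dropped by [mkgraph]. *)
Definition del_vertex G x := mkgraph (vset G :\ x) (eset G).

Definition del_edge G (e : {set T}) := mkgraph (vset G) (eset G :\ e).

(* [y] is merged into [x]; the contracted edge becomes the singleton [set x],
   which [mkgraph] drops, and parallel edges are identified. *)
Definition contract G x y :=
  mkgraph (vset G :\ y)
          [set [set (if z == y then x else z) | z in (e : {set T})]
             | e in eset G].

Inductive minor_step G : sgraph T -> Prop :=
| MinorDelVertex x : x \in vset G -> minor_step G (del_vertex G x)
| MinorDelEdge e : e \in eset G -> minor_step G (del_edge G e)
| MinorContract x y : [set x; y] \in eset G -> minor_step G (contract G x y).

Inductive tree_decomposable : sgraph T -> Prop :=
| TDEdge x y : x != y -> tree_decomposable (edge_graph x y)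
| TDUnion G1 G2 G3 a b c :
    tree_decomposable G1 -> tree_decomposable G2 -> tree_decomposable G3 ->
    vset G1 :&: vset G2 = [set a] ->
    vset G2 :&: vset G3 = [set b] ->
    vset G1 :&: vset G3 = [set c] ->
    a != b -> b != c -> a != c ->
    tree_decomposable (gunion G1 (gunion G2 G3)).

Definition nonedge G x y :=
  [&& x \in vset G, y \in vset G, x != y & [set x; y] \notin eset G].

Definition base_nonedge G x y :=
  nonedge G x y /\ tree_decomposable (add_edge G x y).

Definition one_dof_tree_decomposable G := exists x y, base_nonedge G x y.

Definition cluster G C :=
  [/\ tree_decomposable C, subgraph C G
    & forall C', tree_decomposable C' -> subgraph C' G -> subgraph C C' ->
        C' = C].

(* The data of a step v <| (u, w): [cl1] is attached at [u], [cl2] at [w]. *)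
Record cstep := CStep {
  step_vertex : T;
  base1 : T;
  base2 : T;
  cl1 : sgraph T;
  cl2 : sgraph T
}.

Definition append_step G (s : cstep) := gunion G (gunion (cl1 s) (cl2 s)).

(* The graph obtained from the two isolated vertices [x], [y] after the first
   [k] steps.  Steps are numbered from 0, so the step of index [k] is applied
   to [stage x y ss k]. *)
Definition stage x y (ss : seq cstep) (k : nat) :=
  foldl append_step (mkgraph [set x; y] set0) (take k ss).

Definition valid_step G Gk (s : cstep) :=
  [/\ cluster G (cl1 s) /\ cluster G (cl2 s),
      vset (cl1 s) :&: vset (cl2 s) = [set step_vertex s],
      vset (cl1 s) :&: vset Gk = [set base1 s],
      vset (cl2 s) :&: vset Gk = [set base2 s]
    & base1 s != base2 s].

Definition construction G x y n (ss : n.-tuple cstep) :=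
  [/\ base_nonedge G x y,
      forall k : 'I_n, valid_step G (stage x y ss k) (tnth ss k)
    & stage x y ss n = G].

Definition added_vertices (s : cstep) :=
  (vset (cl1 s) :|: vset (cl2 s)) :\: [set base1 s; base2 s].

Definition final_level n (ss : n.-tuple cstep) (k : 'I_n) :=
  [forall j : 'I_n,
     (base1 (tnth ss j) \notin added_vertices (tnth ss k)) &&
     (base2 (tnth ss j) \notin added_vertices (tnth ss k))].

Definition one_path G :=
  one_dof_tree_decomposable G /\
  exists x y n (ss : n.-tuple cstep),
    construction G x y ss /\ #|[set k | final_level ss k]| = 1.

Definition extreme_graph x y n (ss : n.-tuple cstep) (k : 'I_n) :=
  add_edge (stage x y ss k) (base1 (tnth ss k)) (base2 (tnth ss k)).

(* The construction from a base nonedge is determined up to the order of its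
   steps (and the naming of the two sides of a step), and this order does not
   affect whether all extreme graphs are tree-decomposable. *)
Definition LCC_on G x y :=
  exists n (ss : n.-tuple cstep),
    construction G x y ss /\
    forall k : 'I_n, tree_decomposable (extreme_graph x y ss k).

Definition LCC G := exists x y, base_nonedge G x y /\ LCC_on G x y.

End Graphs.

Definition isomorphic (S T : finType) (H : sgraph S) (G : sgraph T) :=
  exists f : S -> T,
    [/\ {in vset H &, injective f}, f @: vset H = vset G
      & [set f @: (e : {set S}) | e in eset H] = eset G].

Definition has_minor (S T : finType) (G : sgraph T) (H : sgraph S) :=
  exists G' : sgraph T,
    clos_refl_trans (sgraph T) (@minor_step T) G G' /\ isomorphic H G'.

Definition exactly_two (P Q R : Prop) :=
  [\/ [/\ P, Q & ~ R], [/\ P, ~ Q & R] | [/\ ~ P, Q & R]].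

(* Main.v *)
From Stdlib Require Import Relations.
Require Import Defs.
From mathcomp Require Import all_boot.

(** A one-step construction satisfies LCC and 1-path for trivial reasons: its only
    extreme graph is the edge [(u, w)].  Let K be tree-decomposable with vertices
    u <> v, and let G be K with a pendant edge [(v, w)].  Then [(u, w)] is a base
    nonedge with a single step v <| (u, w), whose clusters are K and the edge
    [(v, w)]: these are maximal because a vertex of degree 1 in a
    tree-decomposable graph forces the graph to be an edge.  It remains to find a
    K with a triangle and with H as a minor.  Joining a new vertex to any two
    distinct vertices preserves tree-decomposability, so join all vertices of H
    (and one more, for the triangle) to the ends of an edge [(p, q)], and then
    join one further vertex to the ends of each edge of H; the result contains a
    subdivision of H. *)

Set Implicit Arguments.
Unset Strict Implicit.
Unset Printing Implicit Defensive.

Section Graphs.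
Variable T : finType.
Implicit Types (G K : sgraph T) (V X : {set T}) (E : {set {set T}}).
Implicit Types (e : {set T}) (x y z u v w : T) (N : T -> {set T}).

(** * Extensionality of graphs and membership in edge sets *)

Lemma sgraph_eq G K : vset G = vset K -> eset G = eset K -> G = K.
Proof.
case: G K => [V E p] [V' E' p'] /= eqV eqE; move: p p'; rewrite eqV eqE => p p'.
by rewrite (bool_irrelevance p p').
Qed.

Lemma edgeP G e : e \in eset G -> (#|e| == 2) && (e \subset vset G).
Proof. by move: e; apply/forall_inP; apply: sgraphP. Qed.

Lemma edge_mem G e x : e \in eset G -> x \in e -> x \in vset G.
Proof. by move=> /edgeP/andP[_ /subsetP]; apply. Qed.

(** Here, as in the next two lemmas and in [in_eset_attach], the filter of [mkgraph] discards
    nothing, so edge sets can be computed as plain unions. *)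
Lemma in_eset_edge x y e :
  x != y -> (e \in eset (edge_graph x y)) = (e == [set x; y]).
Proof.
move=> xy; rewrite !inE; case: eqP => [->|//] /=.
by rewrite cards2 xy subxx.
Qed.

Lemma in_eset_gunion G K e :
  (e \in eset (gunion G K)) = (e \in eset G) || (e \in eset K).
Proof.
rewrite !inE; apply: andb_idr => /orP[] /edgeP/andP[-> sub].
  by rewrite (subset_trans sub) ?subsetUl.
by rewrite (subset_trans sub) ?subsetUr.
Qed.

Lemma in_eset_add_edge G x y e :
  x \in vset G -> y \in vset G -> x != y ->
  (e \in eset (add_edge G x y)) = (e == [set x; y]) || (e \in eset G).
Proof.
move=> xG yG xy; rewrite inE in_setU1; apply: andb_idr.
case/predU1P=> [->|/edgeP//]; rewrite cards2 xy /=.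
by apply/subsetP => z /set2P[]->.
Qed.

Lemma subgraph_anti G K : subgraph G K -> subgraph K G -> G = K.
Proof.
move=> /andP[v1 e1] /andP[v2 e2].
by apply: sgraph_eq; apply/eqP; rewrite eqEsubset ?v1 ?v2 ?e1 ?e2.
Qed.

(** * Vertices of degree one in tree-decomposable graphs *)

(** Induction on the decomposition. In a union, each part containing [x] inherits the condition on
    the edges at [x], hence is the edge from [x] to [y]; this contradicts the way the parts meet, so
    only the single-edge case survives. *)
Lemma td_pendant G x y :
  tree_decomposable G -> x \in vset G ->
  {in eset G, forall e, x \in e -> e = [set x; y]} -> G = edge_graph x y.
Proof.
elim=> {G} [a b ab|G1 G2 G3 a b c _ IH1 _ IH2 _ IH3 I12 I23 I13 ab bc ac].
  rewrite [vset _]/= => xab /(_ [set a; b]).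
  by rewrite in_eset_edge // eqxx => /(_ isT xab) eq_ab; rewrite /edge_graph eq_ab.
(* If an edge part contained [x], its two shared vertices would be [x] and [y];
   the part sharing [x] would then be the same edge and share [y] as well. *)
have absurd (K K1 K2 : sgraph T) (d d' : T) :
    (x \in vset K -> K = edge_graph x y) ->
    (x \in vset K1 -> K1 = edge_graph x y) ->
    (x \in vset K2 -> K2 = edge_graph x y) ->
    vset K :&: vset K1 = [set d] -> vset K :&: vset K2 = [set d'] -> d != d' ->
    x \in vset K -> False.
  move=> e e1 e2 I1 I2 dd' /e KE.
  have sub_d K' d0 : vset K :&: vset K' = [set d0] -> d0 \in [set x; y].
    by move=> I; have := set11 d0; rewrite -I KE => /setIP[].
  have xy : x != y.
    apply: contraNneq dd' => yx; move: (sub_d _ _ I1) (sub_d _ _ I2).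
    by rewrite -yx setUid !inE => /eqP-> /eqP->.
  have notx K' d0 : vset K :&: vset K' = [set d0] ->
      (x \in vset K' -> K' = edge_graph x y) -> x != d0.
    move=> I e'; apply/eqP => xd; have := set11 d0; rewrite -I -xd => /setIP[_ /e' K'E].
    move: I; rewrite KE K'E setIid => /(congr1 (fun A : {set T} => #|A|)).
    by rewrite cards2 cards1 xy.
  move: (sub_d _ _ I1) (sub_d _ _ I2) dd'; rewrite !inE ![_ == x]eq_sym.
  rewrite (negPf (notx _ _ I1 e1)) (negPf (notx _ _ I2 e2)) /=.
  by move=> /eqP-> /eqP->; rewrite eqxx.
move=> xG inc.
(* The edges of a part are edges of the union, so the condition on edges at [x] can be discharged
   from each induction hypothesis. *)
have edge_part K : (x \in vset K ->
      {in eset K, forall e, x \in e -> e = [set x; y]} -> K = edge_graph x y) ->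
    {subset eset K <= eset (gunion G1 (gunion G2 G3))} ->
    x \in vset K -> K = edge_graph x y.
  by move=> IH sub xK; apply: IH => // e /sub; apply: inc.
have {}IH1 := edge_part _ IH1; have {}IH2 := edge_part _ IH2.
have {}IH3 := edge_part _ IH3.
have {}IH1 : x \in vset G1 -> G1 = edge_graph x y.
  by apply: IH1 => e He; rewrite !in_eset_gunion He.
have {}IH2 : x \in vset G2 -> G2 = edge_graph x y.
  by apply: IH2 => e He; rewrite !in_eset_gunion He orbT.
have {}IH3 : x \in vset G3 -> G3 = edge_graph x y.
  by apply: IH3 => e He; rewrite !in_eset_gunion He !orbT.
exfalso; move: xG; rewrite !inE => /or3P[].
- exact: absurd IH1 IH2 IH3 I12 I13 ac.
- by rewrite setIC in I12; apply: absurd IH2 IH1 IH3 I12 I23 ab.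
- rewrite setIC in I13; rewrite setIC in I23; rewrite eq_sym in bc.
  exact: absurd IH3 IH1 IH2 I13 I23 bc.
Qed.

(** * Attaching new vertices to pairs of old ones *)

Definition star X N := [set [set x; a] | x in X, a in N x].

Lemma mem_star X N x a : x \in X -> a \in N x -> [set x; a] \in star X N.
Proof. by move=> xX aN; apply/imset2P; exists x a. Qed.

Definition attach G X N : sgraph T :=
  mkgraph (vset G :|: X) (eset G :|: star X N).

(** New vertices have both neighbours in [V] and are thus pairwise nonadjacent, so they can be
    attached one at a time in any order. *)
Definition attachable V X N :=
  {in X, forall x, [/\ x \notin V, N x \subset V & #|N x| == 2]}.

Lemma in_eset_attach G X N e : attachable (vset G) X N ->
  (e \in eset (attach G X N)) =
  (e \in eset G) || (e \in star X N).
Proof.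
move=> ok; rewrite !inE; apply: andb_idr => /orP[/edgeP/andP[-> sub]|].
  by rewrite (subset_trans sub) ?subsetUl.
case/imset2P=> x a xX aN ->; have [xV NV _] := ok x xX.
have aV := subsetP NV _ aN; rewrite cards2.
rewrite (_ : x != a) /=; last by apply: contraNneq xV => ->.
by apply/subsetP => z; rewrite !inE => /orP[]/eqP->; rewrite ?aV ?xX ?orbT.
Qed.

Lemma attach0 G N : attach G set0 N = G.
Proof.
have ok : attachable (vset G) set0 N by move=> x; rewrite inE.
apply: sgraph_eq; first by rewrite [LHS]setU0.
apply/setP => e; rewrite in_eset_attach // orbC.
by case: imset2P => // -[x a]; rewrite inE.
Qed.

Lemma attachable_sub V X (Y : {set T}) N : Y \subset X -> attachable V X N -> attachable V Y N.
Proof. by move=> /subsetP sub ok x /sub; apply: ok. Qed.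

Lemma set_ind (P : {set T} -> Prop) :
  P set0 -> (forall x X, x \notin X -> P X -> P (x |: X)) -> forall X, P X.
Proof.
move=> P0 PS X; move eqn : #|X| => n; elim: n X eqn => [|n IH] X.
  by move=> /eqP; rewrite cards_eq0 => /eqP->.
move=> cX; have /card_gt0P[x xX] : 0 < #|X| by rewrite cX.
rewrite -(setD1K xX); apply: PS; first by rewrite !inE eqxx.
by apply: IH; apply: succn_inj; rewrite -cX [RHS](cardsD1 x) xX.
Qed.

(** If [N x] is [[set a; b]], attaching [x] is a union of three parts: the graph built so far and
    the edges from [x] to [a] and to [b]. They meet pairwise in the distinct vertices [a], [x],
    [b]. *)
Lemma td_attach G X N :
  tree_decomposable G -> attachable (vset G) X N ->
  tree_decomposable (attach G X N).
Proof.
move=> tdG; elim/set_ind: X => [|x X xX IH] ok; first by rewrite attach0.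
have okX := attachable_sub (subsetUr _ _) ok.
have [xV NV /cards2P[a [b [ab Nx]]]] := ok x (setU11 _ _).
have aV : a \in vset G by apply: (subsetP NV); rewrite Nx !inE eqxx.
have bV : b \in vset G by apply: (subsetP NV); rewrite Nx !inE eqxx orbT.
have xa : x != a by apply: contraNneq xV => ->.
have xb : x != b by apply: contraNneq xV => ->.
rewrite (_ : attach _ _ _ =
  gunion (attach G X N) (gunion (edge_graph x a) (edge_graph x b))); last first.
  apply: sgraph_eq.
    apply/setP => z; rewrite !inE; case: eqP => [->|_] /=; rewrite ?orbT //.
    case: eqP => [->|_]; first by rewrite aV.
    by case: eqP => [->|_]; rewrite ?bV ?orbF.
  apply/setP => e; rewrite !in_eset_gunion !in_eset_attach // !in_eset_edge //.
  rewrite -orbA; congr orb; apply/imset2P/idP => [[z c]|].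
    rewrite !inE => /predU1P[->|zX].
      by rewrite Nx !inE => /orP[]/eqP-> ->; rewrite eqxx !orbT.
    by move=> cN ->; rewrite mem_star.
  case/or3P=> [/imset2P[z c zX cN ->]|/eqP->|/eqP->].
  + by exists z c; rewrite // inE zX orbT.
  + by exists x a; rewrite ?Nx ?inE ?eqxx.
  + by exists x b; rewrite ?Nx ?inE ?eqxx ?orbT.
apply: (@TDUnion _ _ _ _ a x b (IH okX) (TDEdge xa) (TDEdge xb)) => //.
- apply/setP => z; rewrite !inE; case: (eqVneq z a) => [->|_].
    by rewrite aV orbT.
  by case: eqP => [->|_]; rewrite ?andbF // (negPf xV) (negPf xX).
- apply/setP => z; rewrite !inE; case: (eqVneq z x) => //= _.
  by case: eqP => [->|] //; rewrite (negPf ab).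
- apply/setP => z; rewrite !inE; case: (eqVneq z b) => [->|_].
    by rewrite bV orbT.
  by case: eqP => [->|_]; rewrite ?andbF // (negPf xV) (negPf xX).
- by rewrite eq_sym.
Qed.

(** * Minors by deletion and by contraction of subdivided edges *)

Local Notation minor := (clos_refl_trans (sgraph T) (@minor_step T)).

(** Induction on the number of vertices plus edges: first delete vertices outside [K], which
    destroys no edge of [K]; once the vertex sets agree, delete the surplus edges. *)
Lemma subgraph_minor G K : subgraph K G -> minor G K.
Proof.
have [n] := ubnP (#|vset G| + #|eset G|); elim: n G => // n IH G leG sub.
have /andP[Vsub Esub] := sub.
have [VE|] := boolP (vset G \subset vset K); last first.
  case/subsetPn=> x xG xK.
  apply: (@rt_trans _ _ _ (del_vertex G x)); first by apply: rt_step; constructor.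
  apply: IH; last first.
    rewrite /subgraph subsetD1 Vsub xK /=; apply/subsetP => e eK.
    rewrite inE (subsetP Esub) //=; have /edgeP/andP[-> eV] := eK.
    by rewrite subsetD1 (subset_trans eV) //=; apply: contraNN xK; apply: edge_mem.
  move: leG; rewrite ltnS; apply: leq_trans; rewrite -addSn leq_add //.
    by rewrite [#|vset G|](cardsD1 x) xG.
  by apply: subset_leq_card; apply/subsetP => e; rewrite inE => /andP[].
have [EE|] := boolP (eset G \subset eset K).
  rewrite (_ : G = K); first exact: rt_refl.
  by apply: subgraph_anti; rewrite // /subgraph VE.
case/subsetPn=> e eG eK.
apply: (@rt_trans _ _ _ (del_edge G e)); first by apply: rt_step; constructor.
have sub_del : eset (del_edge G e) \subset eset G :\ e.
  by apply/subsetP => e'; rewrite inE => /andP[].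
apply: IH; last first.
  rewrite /subgraph Vsub /=; apply/subsetP => e' e'K.
  rewrite !inE (subsetP Esub) // (contraNneq _ eK) => [|<- //].
  by have /edgeP/andP[-> /subset_trans->] := e'K.
move: leG; rewrite ltnS; apply: leq_trans; rewrite -addnS leq_add //.
by rewrite [#|eset G|](cardsD1 e) eG ltnS subset_leq_card.
Qed.

(** Each attached vertex is the middle of a path between the two elements of [N x]; contracting one
    half of the path leaves the edge [N x]. The induction is over all [G], because each contraction
    enlarges its edge set. *)
Lemma attach_minor G X N :
  attachable (vset G) X N ->
  minor (attach G X N) (mkgraph (vset G) (eset G :|: N @: X)).
Proof.
elim/set_ind: X G => [|x X xX IH] G ok.
  rewrite attach0 imset0 setU0 (_ : mkgraph _ _ = G); first exact: rt_refl.
  apply: sgraph_eq => //; apply/setP => e; rewrite inE.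
  by apply: andb_idr; apply: edgeP.
have okX := attachable_sub (subsetUr _ _) ok.
have [xV NV Ncard] := ok x (setU11 _ _).
have /cards2P[a [b [ab Nx]]] := Ncard.
have aV : a \in vset G by apply: (subsetP NV); rewrite Nx !inE eqxx.
have bV : b \in vset G by apply: (subsetP NV); rewrite Nx !inE eqxx orbT.
have xa : x != a by apply: contraNneq xV => ->.
have xb : x != b by apply: contraNneq xV => ->.
(* The graph [G] with [x] replaced by an edge between its two neighbours; the induction hypothesis
   treats the other vertices over [G']. *)
pose G' := mkgraph (vset G) (N x |: eset G).
have inG' e : (e \in eset G') = (e == N x) || (e \in eset G).
  by rewrite !inE; apply: andb_idr => /predU1P[->|/edgeP//]; rewrite NV andbT.
rewrite (_ : mkgraph _ _ = mkgraph (vset G') (eset G' :|: N @: X)); last first.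
  by apply: sgraph_eq => //; apply/setP => e; rewrite imsetU1 [LHS]inE
    [RHS]inE !in_setU in_set1 inG' orbCA orbA.
apply: rt_trans (IH G' okX); apply: rt_step.
rewrite (_ : attach G' X N = contract (attach G (x |: X) N) a x).
  constructor; rewrite in_eset_attach //; apply/orP; right; rewrite setUC.
  by rewrite mem_star ?setU11 // Nx !inE eqxx.
have fix_img e : x \notin e -> [set (if z == x then a else z) | z in e] = e.
  move=> xe; rewrite -[RHS]imset_id; apply: eq_in_imset => z ze.
  by case: eqP => // zx; rewrite -zx ze in xe.
have xE e : e \in eset (attach G X N) -> x \notin e.
  by move=> eE; apply/negP => /(edge_mem eE); rewrite inE (negPf xV) (negPf xX).
have imgE c : c != x -> [set (if z == x then a else z) | z in [set x; c]] = [set a; c].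
  by move=> cx; rewrite imsetU1 imset_set1 eqxx (negPf cx).
apply: sgraph_eq.
  apply/setP => z; rewrite !inE; case: (eqVneq z x) => [->|//].
  by rewrite (negPf xV) (negPf xX).
apply/setP => e; rewrite in_eset_attach // inG' -orbA -in_eset_attach //.
(* Under the contraction [[set x; a]] collapses to a singleton and is dropped, [[set x; b]] becomes
   [N x], and every other edge avoids [x] and is fixed. *)
apply/idP/idP => [|]; last first.
  rewrite inE => /andP[/imsetP[e' e'E ->] ]; rewrite in_eset_attach // in e'E.
  case/orP: e'E => [e'G _|].
    by rewrite fix_img ?in_eset_attach ?e'G ?orbT // xE // in_eset_attach ?e'G.
  case/imset2P=> z c /setU1P[->|zX] cN ->; last first.
    have zcE : [set z; c] \in eset (attach G X N).
      by rewrite in_eset_attach // mem_star ?orbT.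
    by rewrite fix_img ?zcE ?orbT // xE.
  move: cN; rewrite Nx => /set2P[]->; rewrite imgE 1?eq_sym //.
    by rewrite setUid cards1.
  by rewrite eqxx.
move=> H; rewrite inE; apply/andP; split; last first.
  move: H; case/predU1P=> [->|eE].
    rewrite Ncard subsetD1 (subset_trans NV) ?subsetUl //=.
    by apply: contraNN xV; apply: subsetP.
  have /andP[-> sub] := edgeP eE; rewrite subsetD1 xE // andbT.
  by rewrite (subset_trans sub) // setUS // subsetUr.
apply/imsetP; case/predU1P: H => [->|eE].
  exists [set x; b]; last by rewrite imgE 1?eq_sym.
  by rewrite in_eset_attach // mem_star ?orbT ?setU11 // Nx !inE eqxx orbT.
exists e; last by rewrite fix_img ?xE.
move: eE; rewrite !in_eset_attach // => /orP[->//|/imset2P[z c zX cN ->]].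
by rewrite mem_star ?orbT // inE zX orbT.
Qed.

(** * The one-step construction from a pendant edge *)

Section Pendant.
Variables (K : sgraph T) (u v w : T).
Hypotheses (tdK : tree_decomposable K) (uK : u \in vset K) (vK : v \in vset K).
Hypotheses (wK : w \notin vset K) (uv : u != v).

Let G := gunion K (edge_graph v w).

Let uw : u != w. Proof. by apply: contraNneq wK => <-. Qed.
Let vw : v != w. Proof. by apply: contraNneq wK => <-. Qed.

Let in_eset_G e : (e \in eset G) = (e \in eset K) || (e == [set v; w]).
Proof. by rewrite in_eset_gunion in_eset_edge. Qed.

Let uG : u \in vset G. Proof. by rewrite inE uK. Qed.
Let wG : w \in vset G. Proof. by rewrite !inE eqxx !orbT. Qed.

Let KIedge : vset K :&: vset (edge_graph v w) = [set v].
Proof.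
apply/setP => z; rewrite !inE; case: (eqVneq z v) => [->|_] /=; first by rewrite vK.
by case: eqP => [->|_]; rewrite ?andbF // (negPf wK).
Qed.

(** With the edge between [u] and [w] added, [G] is the union of [K] and two edges, and these parts
    meet pairwise in [v], [w], [u]. *)
Lemma pendant_base_nonedge : base_nonedge G u w.
Proof.
split.
  rewrite /nonedge uG wG uw in_eset_G /=; apply/norP; split.
    by apply: contraNN wK => /edge_mem; apply; rewrite !inE eqxx orbT.
  apply: contraNneq uv => /setP/(_ u); rewrite !inE eqxx /= (negPf uw) orbF.
  by move=> /esym/eqP->.
rewrite (_ : add_edge _ _ _ =
  gunion K (gunion (edge_graph v w) (edge_graph w u))); last first.
  apply: sgraph_eq.
    apply/setP => z; rewrite !inE; case: (eqVneq z u) => [->|_]; rewrite ?uK //.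
    by rewrite orbF; case: (z == w); rewrite ?orbT ?orbF.
  have wu : w != u by rewrite eq_sym.
  apply/setP => e; rewrite in_eset_add_edge // in_eset_G !in_eset_gunion.
  by rewrite !in_eset_edge // [[set w; u]]setUC orbC orbA.
apply: (@TDUnion _ _ _ _ v w u tdK (TDEdge vw)) => //.
- by apply: TDEdge; rewrite eq_sym.
- apply/setP => z; rewrite !inE; case: (eqVneq z w) => [->|_]; rewrite ?orbT //=.
  by rewrite orbF; case: eqP => //= ->; rewrite eq_sym (negPf uv).
- apply/setP => z; rewrite !inE; case: (eqVneq z u) => [->|_]; rewrite ?uK ?orbT //=.
  by rewrite orbF; case: eqP => [->|_]; rewrite ?andbF // (negPf wK).
- by rewrite eq_sym.
- by rewrite eq_sym.
Qed.

Let w_edge e : e \in eset G -> w \in e -> e = [set w; v].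
Proof.
rewrite in_eset_G => /orP[/edge_mem eK /eK|/eqP-> _]; first by rewrite (negPf wK).
by rewrite setUC.
Qed.

(** The only edge of [G] at [w] leads to [v], so [td_pendant] applies to [C]. Maximality of both
    clusters rests on this. *)
Let td_at_w C : tree_decomposable C -> subgraph C G -> w \in vset C ->
  C = edge_graph v w.
Proof.
move=> tdC /andP[_ /subsetP sub] wC; rewrite /edge_graph setUC.
by apply: td_pendant => // e /sub; apply: w_edge.
Qed.

Let subKG : subgraph K G.
Proof.
by rewrite /subgraph subsetUl; apply/subsetP => e eK; rewrite in_eset_G eK.
Qed.

Let cluster_edge : cluster G (edge_graph v w).
Proof.
split=> [||C tdC CG /andP[sub _]]; first exact: TDEdge.
  rewrite /subgraph subsetUr; apply/subsetP => e.
  by rewrite in_eset_edge // in_eset_G => ->; rewrite orbT.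
by apply: td_at_w => //; apply: (subsetP sub); rewrite !inE eqxx orbT.
Qed.

(** A larger tree-decomposable subgraph containing [w] would be the edge from [v] to [w], which
    misses [u]; one avoiding [w] lies inside [K]. *)
Let cluster_K : cluster G K.
Proof.
split=> // C tdC CG subC.
have wC : w \notin vset C.
  apply/negP => wC; move: subC; rewrite (td_at_w tdC CG wC) => /andP[/subsetP sub _].
  by have := sub _ uK; rewrite !inE (negPf uv) (negPf uw).
apply: subgraph_anti => //; apply/andP; move: CG => /andP[/subsetP Vs /subsetP Es].
split; last first.
  apply/subsetP => e eC; have := Es _ eC; rewrite in_eset_G => /orP[//|/eqP ew].
  by case/negP: wC; apply: (edge_mem eC); rewrite ew !inE eqxx orbT.
apply/subsetP => z zC.
have := Vs _ zC; rewrite !inE => /or3P[//|/eqP->//|/eqP zw].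
by rewrite -zw zC in wC.
Qed.

Lemma pendant_one_step : exists ss : 1.-tuple (cstep T),
  [/\ construction G u w ss, #|[set k | final_level ss k]| = 1
    & forall k : 'I_1, tree_decomposable (extreme_graph u w ss k)].
Proof.
pose s := CStep v u w K (edge_graph v w).
exists [tuple s]; split.
- split; first exact: pendant_base_nonedge.
    move=> k; rewrite (ord1 k) (tnth_nth s) /=.
    split=> //=.
      apply/setP => z; rewrite !inE; case: (eqVneq z u) => [->|_]; rewrite ?uK //=.
      by case: eqP => [->|]; rewrite ?(negPf wK) ?andbF.
    apply/setP => z; rewrite !inE; case: (eqVneq z w) => [->|_]; rewrite ?orbT //=.
    by rewrite !orbF; case: eqP => //= ->; rewrite eq_sym (negPf uv).
  rewrite /stage /= /append_step /=; apply: sgraph_eq.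
    apply/setP => z; rewrite !inE; case: (eqVneq z u) => [->|_]; rewrite ?uK //=.
    by case: (z == w); rewrite ?orbT ?orbF.
  apply/setP => e; rewrite in_eset_gunion (_ : eset (mkgraph _ set0) = set0) ?inE //.
  by apply/setP => e'; rewrite !inE.
(* The only base vertices are [u] and [w], which [added_vertices] removes, so the single step is
   final-level. *)
- rewrite (_ : [set k | _] = setT) ?cardsT ?card_ord //; apply/setP => k.
  rewrite !inE; apply/forallP => j; rewrite (ord1 k) (ord1 j) /=.
  by rewrite !(tnth_nth s) /= !inE !eqxx ?orbT.
(* Before step 0 the graph is just the isolated vertices [u] and [w]. *)
- move=> k; rewrite (ord1 k) /extreme_graph !(tnth_nth s) /=.
  rewrite (_ : add_edge _ _ _ = edge_graph u w); first exact: TDEdge.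
  apply: sgraph_eq => //; apply/setP => e.
  by rewrite in_eset_add_edge ?in_eset_edge ?inE ?eqxx ?orbT ?orbF.
Qed.

End Pendant.
End Graphs.

(** * The graph containing a given minor *)

Theorem mainTheorem4 (S : finType) (H : sgraph S) :
  exists (T : finType) (G : sgraph T),
    [/\ one_dof_tree_decomposable G, has_minor G H
      & exactly_two (LCC G) (one_path G) (K3_free G)].
Proof.
(* The summands hold four auxiliary vertices, the copies [s x] of the elements of [S], and the
   subdivision vertices [m e]. *)
pose T : finType := (bool * bool + S + {set S})%type.
pose s (x : S) : T := inl (inr x); pose m (e : {set S}) : T := inr e.
pose p : T := inl (inl (true, true)); pose q : T := inl (inl (true, false)).
pose r : T := inl (inl (false, true)); pose w : T := inl (inl (false, false)).
have s_inj : injective s by move=> x y [].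
pose N1 (_ : T) := [set p; q].
(* A subdivision vertex [m e] is joined to the copies of the ends of [e]; [set0] is a default
   value. *)
pose N2 (t : T) := if t is inr e then s @: e else set0.
(* All of [S] is attached here, even outside [vset H]; the surplus is deleted when passing to the
   minor. The vertex [r] forms a triangle with [p] and [q]. *)
pose K1 := attach (edge_graph p q) (r |: s @: setT) N1.
pose K := attach K1 (m @: eset H) N2.
have ok1 : attachable (vset (edge_graph p q)) (r |: s @: setT) N1.
  move=> x xX; rewrite cards2 subxx; split=> //; apply: contraTN xX.
  by rewrite !inE => /orP[]/eqP->; apply/imsetP => -[].
have ok2 : attachable (vset K1) (m @: eset H) N2.
  move=> _ /imsetP[e eH ->]; have /edgeP/andP[/eqP card_e _] := eH; split.
  - rewrite !inE /=; apply/imsetP => -[] //.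
  - apply/subsetP => _ /imsetP[x xe ->]; rewrite !inE /= imset_f ?orbT //.
  - by rewrite card_imset // card_e.
have tdK : tree_decomposable K by do 2!apply: td_attach => //; apply: TDEdge.
pose G := gunion K (edge_graph q w).
have pK : p \in vset K by rewrite !inE eqxx.
have qK : q \in vset K by rewrite !inE eqxx orbT.
have wK : w \notin vset K.
  by rewrite !inE /=; apply/norP; split; apply/imsetP => -[].
have baseG : base_nonedge G p w by apply: pendant_base_nonedge.
have dofG : one_dof_tree_decomposable G by exists p, w.
exists T, G; split=> //.
- exists (mkgraph (s @: vset H) (N2 @: (m @: eset H))).
  (* Attaching the vertices [m e] to this edgeless graph yields the subdivision of [H], a subgraph
     of [G]; [attach_minor] then contracts it to a copy of [H]. *)
  pose K0 : sgraph T := mkgraph (s @: vset H) set0.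
  have ok0 : attachable (vset K0) (m @: eset H) N2.
    move=> _ /imsetP[e eH ->]; have /edgeP/andP[/eqP card_e eV] := eH; split.
    + by apply/imsetP => -[].
    + exact: imsetS.
    + by rewrite card_imset // card_e.
  have K00 : eset K0 = set0 by apply/setP => e; rewrite !inE.
  split.
    have := attach_minor ok0; rewrite K00 set0U; apply: rt_trans.
    apply: subgraph_minor; apply/andP; split.
      apply/subsetP => z; rewrite !inE => /orP[/imsetP[x _ ->]|->].
        by rewrite imset_f ?orbT.
      by rewrite !orbT.
    apply/subsetP => e; rewrite in_eset_attach // K00 inE in_eset_gunion.
    by rewrite in_eset_attach // => /= ->; rewrite orbT.
  exists s; split=> //; first by move=> x y _ _; apply: s_inj.
  apply/setP => e; rewrite inE -imset_comp; apply/idP/andP => [eH|[]//].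
  split=> //; move: eH => /imsetP[e' /edgeP/andP[/eqP ce' e'V] ->].
  by rewrite card_imset // ce' imsetS.
have [ss [css fss lss]] := pendant_one_step tdK pK qK wK isT.
apply: Or31; split; last first.
- move=> noK3; apply: noK3; exists p, q, r.
  have rX : r \in r |: s @: setT by rewrite !inE eqxx.
  split; rewrite in_eset_gunion in_eset_attach // in_eset_attach // in_eset_edge // ?eqxx //.
    by rewrite [[set q; r]]setUC mem_star ?orbT // !inE eqxx ?orbT.
  by rewrite [[set p; r]]setUC mem_star ?orbT // !inE eqxx ?orbT.
- by split=> //; exists p, w, 1, ss.
by exists p, w; split=> //; exists 1, ss.
Qed.
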